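(* Let $\mathbb{F}$ be a field of characteristic zero, let $W(2)$ be the conservative algebra over $\mathbb{F}$ of all multiplications on a $2$-dimensional vector space, let $W_2\subseteq W(2)$ be the subalgebra of all commutative multiplications, and let $S_2\subseteq W_2$ be the subalgebra of all commutative multiplications with zero multiplication trace. Then, for each algebra $\mathcal{A}\in\{S_2,W_2,W(2)\}$, every $2$-local derivation $\Delta:\mathcal{A}\to\mathcal{A}$ is a derivation of $\mathcal{A}$.
   Context: Let $V_2$ be a $2$-dimensional vector space over $\mathbb{F}$ with a basis $v_1,v_2$. The algebra $W(2)$ is the $8$-dimensional vector space of all multiplications on $V_2$, i.e. all bilinear maps $V_2\times V_2\to V_2$, with the (nonassociative) product $$(A\cdot B)(x,y)=A(v_1,B(x,y))-B(A(v_1,x),y)-B(x,A(v_1,y)),\qquad x,y\in V_2,\ A,B\in W(2).$$ For $i,j,k\in\{1,2\}$ let $\alpha^k_{ij}\in W(2)$ be given by $\alpha^k_{ij}(v_t,v_l)=\delta_{it}\delta_{jl}v_k$. The subalgebra $W_2\subseteq W(2)$ is the $6$-dimensional subspace of all commutative (symmetric) multiplications. The subalgebra $S_2\subseteq W_2$ is the $4$-dimensional subspace of commutative multiplications with zero multiplication trace (every left multiplication operator has trace zero); it has basis $$e_1=\alpha^1_{11}-\alpha^2_{12}-\alpha^2_{21},\quad e_2=\alpha^2_{11},\quad e_3=\alpha^2_{22}-\alpha^1_{12}-\alpha^1_{21},\quad e_4=\alpha^1_{22}.$$ For a (not necessarily associative) $\mathbb{F}$-algebra $\mathcal{A}$: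 a linear map $D:\mathcal{A}\to\mathcal{A}$ is a derivation if $D(xy)=D(x)y+xD(y)$ for all $x,y\in\mathcal{A}$. A (not necessarily linear) map $\Delta:\mathcal{A}\to\mathcal{A}$ is a $2$-local derivation if for any $x,y\in\mathcal{A}$ there exists a derivation $D_{x,y}:\mathcal{A}\to\mathcal{A}$ such that $\Delta(x)=D_{x,y}(x)$ and $\Delta(y)=D_{x,y}(y)$. *)

(* Defs.v *)
From HB Require Import structures.
From mathcomp Require Import all_boot all_order all_algebra.

Set Implicit Arguments.
Unset Strict Implicit.
Unset Printing Implicit Defensive.

Import GRing.Theory passmx.

Local Open Scope ring_scope.

(* A nonassociative algebra is an lmodType together with a product. *)
Section Derivations.
Variables (F : fieldType) (A : lmodType F) (mul : A -> A -> A).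

Definition is_derivation (D : A -> A) : Prop :=
  linear D /\ (forall x y : A, D (mul x y) = mul (D x) y + mul x (D y)).

Definition is_2local_derivation (Delta : A -> A) : Prop :=
  forall x y : A, exists D : A -> A,
    [/\ is_derivation D, Delta x = D x & Delta y = D y].

End Derivations.

(* The product induced on a subspace U.  The projection vsproj U is the        *)
(* identity on U, so it is harmless when U is closed under mul (see sub_mulE).  *)
Definition sub_mul (F : fieldType) (A : vectType F) (mul : A -> A -> A)
    (U : {vspace A}) (x y : subvs_of U) : subvs_of U :=
  vsproj U (mul (vsval x) (vsval y)).
Arguments sub_mul {F A} mul U x y.

Lemma sub_mulE (F : fieldType) (A : vectType F) (mul : A -> A -> A)
    (U : {vspace A}) (x y : subvs_of U) :
  (forall a b, a \in U -> b \in U -> mul a b \in U) ->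
  vsval (sub_mul mul U x y) = mul (vsval x) (vsval y).
Proof. by move=> Umul; rewrite vsprojK // Umul ?subvsP. Qed.

(* Multiplications on V in curried form: A x is the left multiplication by x. *)
Notation multiplication V := 'Hom(V, 'Hom(V, V)).

Lemma linfun_linear (F : fieldType) (U V : vectType F) (f : U -> V) :
  linear f -> linfun f =1 f.
Proof.
move=> f_lin.
pose g : {linear U -> V} :=
  HB.pack f (GRing.isSemilinear.Build F U V _ f (GRing.semilinear_linear f_lin)).
exact: (lfunE g).
Qed.

Section Multiplications.
Variables (F : fieldType) (V : vectType F).
Implicit Types (A B : multiplication V) (v x y : V).

(* A \cdot B, with v in the role of v_1; the pointwise formula is mulWE. *)
Definition mulW v A B : multiplication V :=
  linfun (fun x => (A v \o B x)%VF - B (A v x) - (B x \o A v)%VF).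

Lemma mulW_lfun v A B x :
  mulW v A B x = (A v \o B x)%VF - B (A v x) - (B x \o A v)%VF.
Proof.
rewrite /mulW linfun_linear // => a {}x y; apply/lfunP => z.
do ![rewrite lfunE /=].
rewrite !linearP /=; do ![rewrite lfunE /=].
rewrite linearP /= !opprD 2![in RHS]scalerDr !scalerN.
by rewrite [in RHS]addrACA [X in _ = X + _]addrACA.
Qed.

Lemma mulWE v A B x y :
  mulW v A B x y = A v (B x y) - B (A v x) y - B x (A v y).
Proof. by rewrite mulW_lfun; do ![rewrite lfunE /=]. Qed.

Definition opposite A : multiplication V :=
  linfun (fun x => linfun (fun y => A y x)).

Lemma oppositeE A x y : opposite A x y = A y x.
Proof.
have lin1 z : linear (fun t => A t z).
  by move=> a t u; rewrite linearP /= !lfunE /= lfunE.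
rewrite /opposite linfun_linear ?linfun_linear // => a t u; apply/lfunP => z.
by rewrite !lfunE /= lfunE /= !linfun_linear // linearP.
Qed.

Definition commutative_mults : {vspace multiplication V} :=
  lker (linfun (fun A => A - opposite A)).

Lemma commutative_multsP A :
  reflect (forall x y, A x y = A y x) (A \in commutative_mults).
Proof.
rewrite memv_ker linfun_linear; last first.
  move=> a B C; apply/lfunP => x; apply/lfunP => y.
  do ![rewrite (lfunE, oppositeE) /=].
  by rewrite opprD scalerDr scalerN addrACA.
rewrite subr_eq0; apply: (iffP eqP) => [A_opp x y | A_comm].
  by rewrite {1}A_opp oppositeE.
by apply/lfunP => x; apply/lfunP => y; rewrite oppositeE.
Qed.

(* Independent of the choice of basis, see lftraceE. *)
Definition lftrace (f : 'End(V)) : F :=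
  \tr (mxof (vbasis {:V}) (vbasis {:V}) f).

Lemma lftraceE n (e : n.-tuple V) (f : 'End(V)) :
  basis_of {:V} e -> lftrace f = \sum_(i < n) coord e i (f e`_i).
Proof.
move=> e_basis; have dimV : n = \dim {:V} by rewrite (size_basis e_basis).
subst n; have b_basis := vbasisP {:V}.
have -> : \sum_i coord e i (f e`_i) = \tr (mxof e e f).
  by apply: eq_bigr => i _; rewrite !mxE /= vecof_delta.
rewrite /lftrace -[in LHS](comp_lfun1l f) (mxof_comp _ _ e_basis).
by rewrite mxtrace_mulC -(mxof_comp _ _ b_basis) comp_lfun1r.
Qed.

Definition mult_trace A : 'Hom(V, F^o) :=
  linfun (fun x => lftrace (A x) : F^o).

Lemma mult_traceE A x : mult_trace A x = lftrace (A x).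
Proof.
by rewrite /mult_trace linfun_linear // => a {}x y; rewrite /lftrace !linearP.
Qed.

Definition traceless_commutative_mults : {vspace multiplication V} :=
  (commutative_mults :&: lker (linfun mult_trace))%VS.

Lemma traceless_commutative_multsP A :
  reflect ((forall x y, A x y = A y x) /\ (forall x, lftrace (A x) = 0))
          (A \in traceless_commutative_mults).
Proof.
rewrite memv_cap memv_ker linfun_linear; last first.
  move=> a B C; apply/lfunP => x; do ![rewrite (lfunE, mult_traceE) /=].
  by rewrite /lftrace !linearP.
apply: (iffP andP) => [[/commutative_multsP A_comm /eqP A_tr] | [A_comm A_tr]].
  by split=> // x; rewrite -mult_traceE A_tr lfunE.
split; first exact/commutative_multsP.
by apply/eqP/lfunP => x; rewrite mult_traceE A_tr lfunE.
Qed.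

Lemma commutative_mults_mul v A B :
  A \in commutative_mults -> B \in commutative_mults ->
  mulW v A B \in commutative_mults.
Proof.
move=> _ /commutative_multsP B_comm; apply/commutative_multsP => x y.
by rewrite !mulWE (B_comm x y) addrAC (B_comm x) (B_comm _ y).
Qed.

Lemma traceless_commutative_mults_mul v A B :
  A \in traceless_commutative_mults -> B \in traceless_commutative_mults ->
  mulW v A B \in traceless_commutative_mults.
Proof.
move=> /traceless_commutative_multsP[A_comm _].
case/traceless_commutative_multsP=> B_comm B_tr.
apply/traceless_commutative_multsP; split=> [|x].
  apply/commutative_multsP/commutative_mults_mul; exact/commutative_multsP.
rewrite mulW_lfun /lftrace !linearB /= !(mxof_comp _ _ (vbasisP _)).
rewrite -[\tr (mxof _ _ (B (A v x)))]/(lftrace _) B_tr subr0.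
by rewrite mxtrace_mulC subrr.
Qed.

End Multiplications.

(* Main.v *)
(* A derivation of any of the three algebras is determined by its value at e_2,
   so all the derivations D_{e_2,y} attached to a 2-local derivation coincide.
   Indeed A.B is the natural action of L(A) = A(v1, -) in gl(V) on B, and e_1,
   e_2, e_3 act as a basis of sl(V).  If D e_2 = 0, weight considerations give
   D e_1 = 0 and then D e_3 = 0.  As A.e_1 and A.e_2 lie in <e_1, e_2, e_3>,
   (D A).e_1 = (D A).e_2 = 0, whence L(D A) = 0 for every A; since e_2 maps
   v1 to v2, applying this to e_2.A kills D A on v2 as well. *)

Require Import Defs.
From HB Require Import structures.
From mathcomp Require Import all_boot all_order all_algebra.
From mathcomp Require Import ring.

Set Implicit Arguments.
Unset Strict Implicit.
Unset Printing Implicit Defensive.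

Import GRing.Theory.

Local Open Scope ring_scope.

(** The derivation attached to [(x0, y)] agrees at [x0] with the one attached to [(x0, x0)], hence
    equals it, whatever [y] is. *)
Lemma is_2local_derivation_determined (F : fieldType) (A : lmodType F)
    (mul : A -> A -> A) (x0 : A) :
  (forall D D', is_derivation mul D -> is_derivation mul D' ->
     D x0 = D' x0 -> D =1 D') ->
  forall Delta, is_2local_derivation mul Delta -> is_derivation mul Delta.
Proof.
move=> det Delta Delta2; have [D [derD Dx0 _]] := Delta2 x0 x0.
have DeltaE y : Delta y = D y.
  have [D' [derD' D'x0 ->]] := Delta2 x0 y.
  by apply: (det D' D derD' derD); rewrite -D'x0 -Dx0.
case: derD => linD mulD.
by split=> [a x y | x y]; rewrite !DeltaE ?linD ?mulD.
Qed.

Section LinearExpand.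
Variables (F : fieldType) (U W : vectType F) (f : 'Hom(U, W)).

Lemma lfunD x y : f (x + y) = f x + f y. Proof. exact: linearD. Qed.
Lemma lfunN x : f (- x) = - f x. Proof. exact: linearN. Qed.
Lemma lfunZ a x : f (a *: x) = a *: f x. Proof. exact: linearZ. Qed.
Lemma lfun0 : f 0 = 0. Proof. exact: linear0. Qed.

End LinearExpand.

(** * Coordinates in the plane and multiplications given by tables *)

Section Plane.
Variables (F : fieldType) (V : vectType F) (v1 v2 : V).
Hypothesis v_basis : basis_of {:V} [:: v1; v2].
Implicit Types (A B C : multiplication V) (x y : V).

Definition coord1 : V -> F := coord [tuple v1; v2] ord0.
Definition coord2 : V -> F := coord [tuple v1; v2] ord_max.
HB.instance Definition _ := GRing.Linear.on coord1.
HB.instance Definition _ := GRing.Linear.on coord2.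

Lemma coord1_lin : (forall x y, coord1 (x + y) = coord1 x + coord1 y) *
  (forall x, coord1 (- x) = - coord1 x) *
  (forall a x, coord1 (a *: x) = a * coord1 x) * (coord1 0 = 0).
Proof.
by split; [split; [split|]|]; [exact: linearD | exact: linearN
  | move=> *; exact: linearZ_LR | exact: linear0].
Qed.

Lemma coord2_lin : (forall x y, coord2 (x + y) = coord2 x + coord2 y) *
  (forall x, coord2 (- x) = - coord2 x) *
  (forall a x, coord2 (a *: x) = a * coord2 x) * (coord2 0 = 0).
Proof.
by split; [split; [split|]|]; [exact: linearD | exact: linearN
  | move=> *; exact: linearZ_LR | exact: linear0].
Qed.

Definition linE := (coord1_lin, coord2_lin, lfunD, lfunN, lfunZ, lfun0,
  add_lfunE, opp_lfunE, scale_lfunE, zero_lfunE).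

Lemma v_free : free [tuple v1; v2].
Proof. exact: basis_free v_basis. Qed.

Lemma coord11 : coord1 v1 = 1.
Proof. exact: (coord_free ord0 ord0 v_free). Qed.
Lemma coord12 : coord1 v2 = 0.
Proof. exact: (coord_free ord_max ord0 v_free). Qed.
Lemma coord21 : coord2 v1 = 0.
Proof. exact: (coord_free ord0 ord_max v_free). Qed.
Lemma coord22 : coord2 v2 = 1.
Proof. exact: (coord_free ord_max ord_max v_free). Qed.
Definition coordE := (coord11, coord12, coord21, coord22).

Lemma plane_decomp x : x = coord1 x *: v1 + coord2 x *: v2.
Proof.
rewrite {1}(coord_basis (X := [tuple v1; v2]) v_basis (memvf x)).
by rewrite big_ord_recl big_ord1; congr (_ *: _ + coord _ _ _ *: _); apply: val_inj.
Qed.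

Lemma plane_eq x y : coord1 x = coord1 y -> coord2 x = coord2 y -> x = y.
Proof. by move=> eq1 eq2; rewrite (plane_decomp x) (plane_decomp y) eq1 eq2. Qed.

Lemma mult_eq A B :
  A v1 v1 = B v1 v1 -> A v1 v2 = B v1 v2 ->
  A v2 v1 = B v2 v1 -> A v2 v2 = B v2 v2 -> A = B.
Proof.
move=> e11 e12 e21 e22; apply/lfunP => x; apply/lfunP => y.
rewrite (plane_decomp x) (plane_decomp y).
by rewrite !linE e11 e12 e21 e22.
Qed.

Definition table (a b c d : V) : multiplication V :=
  linfun (fun x => linfun (fun y =>
    (coord1 x * coord1 y) *: a + (coord1 x * coord2 y) *: b
    + (coord2 x * coord1 y) *: c + (coord2 x * coord2 y) *: d)).

Lemma tableE a b c d x y : table a b c d x y =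
    (coord1 x * coord1 y) *: a + (coord1 x * coord2 y) *: b
    + (coord2 x * coord1 y) *: c + (coord2 x * coord2 y) *: d.
Proof.
have lin1 z : linear (fun y =>
    (coord1 z * coord1 y) *: a + (coord1 z * coord2 y) *: b
    + (coord2 z * coord1 y) *: c + (coord2 z * coord2 y) *: d).
  move=> k t u; apply: plane_eq; rewrite !linE; ring.
rewrite /table linfun_linear ?linfun_linear // => k t u; apply/lfunP => z.
rewrite add_lfunE scale_lfunE !linfun_linear //.
by apply: plane_eq; rewrite !linE; ring.
Qed.

(** * Bilinearity of the product and structure constants *)

Lemma mulWBl v A B C : mulW v (A - B) C = mulW v A C - mulW v B C.
Proof.
apply/lfunP => x; apply/lfunP => y.
rewrite !(add_lfunE, opp_lfunE) !mulWE !(add_lfunE, opp_lfunE, lfunD, lfunN) !opprD.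
by rewrite [X in X + _ = _]addrACA [LHS]addrACA.
Qed.

Lemma mulWBr v A B C : mulW v A (B - C) = mulW v A B - mulW v A C.
Proof.
apply/lfunP => x; apply/lfunP => y.
rewrite !(add_lfunE, opp_lfunE) !mulWE !(add_lfunE, opp_lfunE, lfunD, lfunN) !opprD.
by rewrite [X in X + _ = _]addrACA [LHS]addrACA.
Qed.

(** At basis vectors [x] and [y], the right side involves only values of [A] and [B] on the basis,
    so [expandE] computes products entry by entry. *)
Lemma mulW_expand A B x y : mulW v1 A B x y =
  coord1 (B x y) *: A v1 v1 + coord2 (B x y) *: A v1 v2
  - (coord1 (A v1 x) *: B v1 y + coord2 (A v1 x) *: B v2 y)
  - (coord1 (A v1 y) *: B x v1 + coord2 (A v1 y) *: B x v2).
Proof.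
rewrite mulWE {1}(plane_decomp (B x y)) {1}(plane_decomp (A v1 x)).
by rewrite {1}(plane_decomp (A v1 y)) !(lfunD, lfunZ, add_lfunE, scale_lfunE).
Qed.

(* The basis elements of S_2, except e_4 which plays no role. *)
Definition e1 := table v1 (- v2) (- v2) 0.
Definition e2 := table v2 0 0 0.
Definition e3 := table 0 (- v1) (- v1) v2.

Lemma table_values a b c d :
  (table a b c d v1 v1 = a) * (table a b c d v1 v2 = b) *
  (table a b c d v2 v1 = c) * (table a b c d v2 v2 = d).
Proof.
by rewrite !tableE !coordE !(mulr1, mulr0, scale0r, scale1r, addr0, add0r).
Qed.

Definition expandE := (mulW_expand, table_values, linE, coordE, scaler0,
  scale0r, scale1r, oppr0, addr0, add0r, mul0r, mulr0, mulr1, mul1r).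

Lemma mulW_e1_e3 : mulW v1 e1 e3 = e3.
Proof.
apply: mult_eq; rewrite /e1 /e3 !expandE;
  by apply: plane_eq; rewrite !(linE, coordE); ring.
Qed.

Lemma mulW_e2_e3 : mulW v1 e2 e3 = 2 *: e1.
Proof.
apply: mult_eq; rewrite /e1 /e2 /e3 !expandE;
  by apply: plane_eq; rewrite !(linE, coordE); ring.
Qed.

(** The action of [A v1] preserves commutativity and zero trace. No [e3] or $e_4$ term occurs: the
    product vanishes at [(v2, v2)], as [e2] does once an argument is [v2]. *)
Lemma mulW_e2r A :
  mulW v1 A e2 = coord1 (A v1 v2) *: e1 +
    (coord2 (A v1 v2) - 2 * coord1 (A v1 v1)) *: e2.
Proof.
apply: mult_eq; rewrite /e1 /e2 !expandE;
  by apply: plane_eq; rewrite !(linE, coordE); ring.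
Qed.

(** The coefficients here and in [mulW_e2r] together involve all four coordinates of [A v1], so the
    two products can detect that [A v1] is zero. *)
Lemma mulW_e1r A :
  mulW v1 A e1 = - coord1 (A v1 v1) *: e1 + (3 * coord2 (A v1 v1)) *: e2 +
    (2 * coord1 (A v1 v2)) *: e3.
Proof.
apply: mult_eq; rewrite /e1 /e2 /e3 !expandE;
  by apply: plane_eq; rewrite !(linE, coordE); ring.
Qed.

Lemma mulW0l v A : mulW v 0 A = 0.
Proof. by rewrite -{1}(subrr 0) mulWBl subrr. Qed.

Lemma mulW0r v A : mulW v A 0 = 0.
Proof. by rewrite -{1}(subrr 0) mulWBr subrr. Qed.

Lemma plane_comb_eq0 (a b : F) : a *: v1 + b *: v2 = 0 -> a = 0 /\ b = 0.
Proof.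
move=> eq0; have := (congr1 coord1 eq0, congr1 coord2 eq0).
by rewrite !(linE, coordE) !(mulr0, mulr1) addr0 add0r => -[].
Qed.

(** The two hypotheses are the vanishing of the traces of left multiplication by [v1] and by
    [v2]. *)
Lemma table_traceless_commutative a b d :
  coord1 a + coord2 b = 0 -> coord1 b + coord2 d = 0 ->
  table a b b d \in traceless_commutative_mults V.
Proof.
move=> tr1 tr2; apply/traceless_commutative_multsP; split=> [x y|x].
  by rewrite !tableE [X in X + _ = _]addrAC;
    congr (_ *: _ + _ *: _ + _ *: _ + _ *: _); exact: mulrC.
rewrite (lftraceE (e := [tuple v1; v2]) _ v_basis).
rewrite big_ord_recl big_ord1 /= (_ : lift _ _ = ord_max); last exact: val_inj.
rewrite -[coord _ ord0 _]/(coord1 _) -[coord _ ord_max _]/(coord2 _).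
rewrite !tableE !linE !coordE.
transitivity (coord1 x * (coord1 a + coord2 b) +
  coord2 x * (coord1 b + coord2 d)); first by ring.
by rewrite tr1 tr2 !mulr0 addr0.
Qed.

(** * Kernel of the action of [e2] and weights of [e1] *)

Hypotheses (two_neq0 : 2 != 0 :> F) (three_neq0 : 3 != 0 :> F).

Lemma double_eq0 (a : F) : 2 * a = 0 -> a = 0.
Proof. by move/eqP; rewrite mulf_eq0 (negPf two_neq0) => /eqP. Qed.

Lemma eq0_of_subr (a l r : F) : l = r -> a = l - r -> a = 0.
Proof. by move=> ->; rewrite subrr. Qed.

(** Let [N = e2 v1], so [N v1 = v2] and [N v2 = 0]. The hypothesis reads
    [N (B x y) = B (N x) y + B x (N y)]; coordinates are compared at the four basis pairs. *)
Lemma mulW_e2_kernel B : mulW v1 e2 B = 0 ->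
  [/\ B v2 v2 = 0, coord1 (B v1 v2) = 0, coord1 (B v2 v1) = 0
    & coord1 (B v1 v1) = coord2 (B v1 v2) + coord2 (B v2 v1)].
Proof.
move=> e2B.
have eqB x y : mulW v1 e2 B x y = 0 by rewrite e2B !zero_lfunE.
have eq11 : coord1 (B v1 v1) *: v2 - B v2 v1 - B v1 v2 = 0.
  by rewrite -[RHS](eqB v1 v1) /e2 !expandE.
have eq12 : coord1 (B v1 v2) *: v2 - B v2 v2 = 0.
  by rewrite -[RHS](eqB v1 v2) /e2 !expandE.
have eq21 : coord1 (B v2 v1) *: v2 - B v2 v2 = 0.
  by rewrite -[RHS](eqB v2 v1) /e2 !expandE.
have eq22 : coord1 (B v2 v2) *: v2 = 0.
  by rewrite -[RHS](eqB v2 v2) /e2 !expandE.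
have b221 : coord1 (B v2 v2) = 0.
  by move/(congr1 coord2): eq22; rewrite !(linE, coordE) mulr1.
have := congr1 coord2 eq12; rewrite !(linE, coordE) mulr1 => /subr0_eq b12.
have := congr1 coord2 eq21; rewrite !(linE, coordE) mulr1 => /subr0_eq b21.
(* By [b12] and [b21], the [v1]-coordinate of [eq11] is minus twice [coord2 (B v2 v2)]. *)
have b222 : coord2 (B v2 v2) = 0.
  apply: double_eq0; move/(congr1 coord1): eq11.
  by rewrite !(linE, coordE) b12 b21 => /esym/eq0_of_subr; apply; ring.
split; first by apply: plane_eq; rewrite !linE.
- by rewrite b12.
- by rewrite b21.
move/(congr1 coord2): eq11; rewrite !(linE, coordE) mulr1 -addrA -opprD.
by move/subr0_eq->; rewrite addrC.
Qed.

Lemma mulW_e2_kernel_eq0 B : mulW v1 e2 B = 0 ->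
  coord2 (B v1 v1) = 0 -> coord2 (B v1 v2) = 0 -> coord2 (B v2 v1) = 0 ->
  B = 0.
Proof.
move=> /mulW_e2_kernel[b22 b121 b211 b111] b112 b122 b212.
rewrite b122 b212 addr0 in b111.
by apply: mult_eq; rewrite !zero_lfunE //; apply: plane_eq; rewrite !linE.
Qed.

(** [e1 v1] is diagonal with eigenvalues 1 and -1, so [e1] scales each coordinate of [B]. The three
    coordinates left free in the kernel of [e2] have weights -3, -1 and -1. *)
Lemma mulW_e1l11 B :
  mulW v1 e1 B v1 v1 = - coord1 (B v1 v1) *: v1 - (3 * coord2 (B v1 v1)) *: v2.
Proof.
by rewrite /e1 !expandE; apply: plane_eq; rewrite !(linE, coordE); ring.
Qed.

Lemma coord2_mulW_e1l12 B :
  coord2 (mulW v1 e1 B v1 v2) = - coord2 (B v1 v2).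
Proof. by rewrite /e1 !expandE; ring. Qed.

Lemma coord2_mulW_e1l21 B :
  coord2 (mulW v1 e1 B v2 v1) = - coord2 (B v2 v1).
Proof. by rewrite /e1 !expandE; ring. Qed.

(** * Vanishing of a difference of derivations *)

(* A copy A0 of an algebra between S_2 and W(2), embedded by iota; E is iota
   composed with the difference of two derivations that agree at e_2. *)
Section DerivationDifference.
Variables (A0 : lmodType F) (mul : A0 -> A0 -> A0).
Variables (iota : A0 -> multiplication V) (E : A0 -> multiplication V).
Variables g1 g2 g3 : A0.
Hypotheses (iota_lin : linear iota) (iota_inj : injective iota).
Hypothesis iotaM : forall u w, iota (mul u w) = mulW v1 (iota u) (iota w).
Hypotheses (iota_g1 : iota g1 = e1) (iota_g2 : iota g2 = e2)
  (iota_g3 : iota g3 = e3).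
Hypothesis E_lin : linear E.
Hypothesis EM : forall u w,
  E (mul u w) = mulW v1 (E u) (iota w) + mulW v1 (iota u) (E w).
Hypothesis E_g2 : E g2 = 0.

Lemma derivation_diff_span z a b c : iota z = a *: e1 + b *: e2 + c *: e3 ->
  E z = a *: E g1 + c *: E g3.
Proof.
have iota0 : iota 0 = 0
  by rewrite -(subrr g1) addrC -scaleN1r iota_lin scaleN1r addNr.
have E0 : E 0 = 0
  by rewrite -(subrr g1) addrC -scaleN1r E_lin scaleN1r addNr.
(* The trailing 0 gives every summand the shape [a *: u + v] required by [linear]. *)
have -> : a *: e1 + b *: e2 + c *: e3 = iota (a *: g1 + (b *: g2 + (c *: g3 + 0))).
  by rewrite !iota_lin iota_g1 iota_g2 iota_g3 iota0 addr0 addrA.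
by move/iota_inj->; rewrite !E_lin E_g2 scaler0 add0r E0 addr0.
Qed.

(** [E] is applied to $e_1 e_2 = -3e_2$, $e_2 e_1 = 3e_2$ and $e_1 e_1 = -e_1$; the first two right
    sides are killed by [E_g2]. *)
Lemma derivation_diff_e1 : E g1 = 0.
Proof.
have e1e2 : mulW v1 (E g1) e2 = 0.
  have /derivation_diff_span : iota (mul g1 g2) = 0 *: e1 + (-3) *: e2 + 0 *: e3.
    rewrite iotaM iota_g1 iota_g2 mulW_e2r /e1 !expandE.
    by congr (_ *: _); ring.
  rewrite EM E_g2 iota_g1 iota_g2.
  by rewrite mulW0r !scale0r !addr0.
have e2e1 : mulW v1 e2 (E g1) = 0.
  have /derivation_diff_span : iota (mul g2 g1) = 0 *: e1 + 3 *: e2 + 0 *: e3.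
    by rewrite iotaM iota_g1 iota_g2 mulW_e1r /e2 !expandE.
  by rewrite EM E_g2 iota_g1 iota_g2 mulW0l !scale0r !add0r.
have e1e1 : mulW v1 (E g1) e1 + mulW v1 e1 (E g1) = - E g1.
  have /derivation_diff_span : iota (mul g1 g1) = (-1) *: e1 + 0 *: e2 + 0 *: e3.
    by rewrite iotaM iota_g1 mulW_e1r [in LHS]/e1 !expandE.
  by rewrite EM iota_g1 scale0r addr0 scaleN1r.
have [_ _ _ b111] := mulW_e2_kernel e2e1.
have := congr1 (fun B : multiplication V => coord2 (B v1 v1)) e1e2.
rewrite mulW_e2r /e1 /e2 !expandE => b122.
(* With $(a, b)$ the coordinates of [E g1 v1 v1], this entry reads $-2a = -a$ and $3b - 3b = -b$. *)
have := congr1 (fun B : multiplication V => B v1 v1) e1e1.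
rewrite !(add_lfunE, opp_lfunE) mulW_e1l11 mulW_e1r /e1 /e2 /e3 !expandE => e11.
have := congr1 coord1 e11; rewrite !(linE, coordE) => e111.
have := congr1 coord2 e11; rewrite !(linE, coordE) => e112.
have b111_0 : coord1 (E g1 v1 v1) = 0 by apply: (eq0_of_subr (esym e111)); ring.
rewrite b111_0 mulr0 subr0 in b122; rewrite b111_0 b122 add0r in b111.
apply: mulW_e2_kernel_eq0 => //.
by apply: (eq0_of_subr e112); ring.
Qed.

(** By $e_2 e_3 = 2e_1$ and $e_1 e_3 = e_3$, [E g3] is killed by [e2] and has weight 1 under [e1],
    whereas the kernel coordinates have weights -3 and -1. *)
Lemma derivation_diff_e3 : E g3 = 0.
Proof.
have Eg1 := derivation_diff_e1.
have e2e3 : mulW v1 e2 (E g3) = 0.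
  have /derivation_diff_span : iota (mul g2 g3) = 2 *: e1 + 0 *: e2 + 0 *: e3.
    by rewrite iotaM iota_g2 iota_g3 mulW_e2_e3 !scale0r !addr0.
  by rewrite EM E_g2 iota_g2 iota_g3 mulW0l Eg1 scaler0 scale0r !add0r.
have e1e3 : mulW v1 e1 (E g3) = E g3.
  have /derivation_diff_span : iota (mul g1 g3) = 0 *: e1 + 0 *: e2 + 1 *: e3.
    by rewrite iotaM iota_g1 iota_g3 mulW_e1_e3 !scale0r !add0r scale1r.
  by rewrite EM Eg1 iota_g1 iota_g3 mulW0l scaler0 scale1r !add0r.
have sym0 (a : F) : - a = a -> a = 0.
  by move=> Na; apply: double_eq0; rewrite mulr_natl mulr2n -{1}Na addNr.
apply: mulW_e2_kernel_eq0 => //.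
- have := congr1 (fun B : multiplication V => coord2 (B v1 v1)) e1e3.
  rewrite mulW_e1l11 !(linE, coordE) => eq3.
  (* Equating weights -3 and 1 makes four times the coordinate vanish. *)
  do 2 apply: double_eq0.
  by apply: (eq0_of_subr (esym eq3)); ring.
- apply: sym0; rewrite -coord2_mulW_e1l12.
  exact: (congr1 (fun B : multiplication V => coord2 (B v1 v2)) e1e3).
- apply: sym0; rewrite -coord2_mulW_e1l21.
  exact: (congr1 (fun B : multiplication V => coord2 (B v2 v1)) e1e3).
Qed.

Lemma derivation_diff_eq0 u : E u = 0.
Proof.
have Eg1 := derivation_diff_e1; have Eg3 := derivation_diff_e3.
have span0 w a b c : iota w = a *: e1 + b *: e2 + c *: e3 -> E w = 0.
  by move/derivation_diff_span->; rewrite Eg1 Eg3 !scaler0 addr0.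
have E_e2 w : mulW v1 (E w) e2 = 0.
  have : E (mul w g2) = 0.
    by apply: span0; rewrite iotaM iota_g2 mulW_e2r -[LHS]addr0 -(scale0r e3).
  by rewrite EM E_g2 mulW0r addr0 iota_g2.
have E_e1 w : mulW v1 (E w) e1 = 0.
  have : E (mul w g1) = 0 by apply: span0; rewrite iotaM iota_g1 mulW_e1r.
  by rewrite EM Eg1 mulW0r addr0 iota_g1.
(* The coefficients of [e1] and [e2] in both products are read off at [(v1, v1)]. *)
have E_v1 w : E w v1 v1 = 0 /\ E w v1 v2 = 0.
  have eq2 := congr1 (fun B : multiplication V => B v1 v1) (E_e2 w).
  have eq1 := congr1 (fun B : multiplication V => B v1 v1) (E_e1 w).
  move: eq1 eq2; rewrite mulW_e1r mulW_e2r /e1 /e2 /e3 !expandE.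
  case/plane_comb_eq0=> /eqP; rewrite oppr_eq0 => /eqP b111 /eqP.
  rewrite mulf_eq0 (negPf three_neq0) => /eqP b112.
  case/plane_comb_eq0; rewrite b111 mulr0 subr0 => b121 b122.
  by split; apply: plane_eq; rewrite !linE.
(* Since [E (mul g2 u)] is the product of [e2] and [E u], its values at [(v1, v1)] and [(v1, v2)]
   reduce to [- E u v2 v1] and [- E u v2 v2]. *)
have [u11 u12] := E_v1 u; have [] := E_v1 (mul g2 u).
rewrite EM E_g2 mulW0l add0r iota_g2 /e2 !expandE u11 u12 !expandE.
move=> /eqP; rewrite oppr_eq0 => /eqP u21 /eqP; rewrite oppr_eq0 => /eqP u22.
by apply: mult_eq; rewrite !zero_lfunE.
Qed.

End DerivationDifference.

(** One statement serves all three algebras: each embeds multiplicatively with image containing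
    $S_2$, hence preimages of [e1], [e2], [e3]. *)
Lemma is_2local_derivation_over_S2 (A0 : lmodType F) (mul : A0 -> A0 -> A0)
    (iota : A0 -> multiplication V) :
  linear iota -> injective iota ->
  (forall u w, iota (mul u w) = mulW v1 (iota u) (iota w)) ->
  (forall B, B \in traceless_commutative_mults V -> exists u, iota u = B) ->
  forall Delta, is_2local_derivation mul Delta -> is_derivation mul Delta.
Proof.
move=> iota_lin iota_inj iotaM iota_S2.
have [g1 iota_g1] : exists u, iota u = e1.
  by apply/iota_S2/table_traceless_commutative; rewrite !(linE, coordE) ?subrr ?oppr0 ?addr0.
have [g2 iota_g2] : exists u, iota u = e2.
  by apply/iota_S2/table_traceless_commutative; rewrite !(linE, coordE) ?addr0.
have [g3 iota_g3] : exists u, iota u = e3.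
  by apply/iota_S2/table_traceless_commutative; rewrite !(linE, coordE) ?oppr0 ?addr0 ?addNr.
apply: (is_2local_derivation_determined (x0 := g2)).
move=> D D' [linD mulD] [linD' mulD'] DD'g2 u; apply: (iota_inj _ _); apply: subr0_eq.
apply: (derivation_diff_eq0 (E := fun z => iota (D z) - iota (D' z))
  iota_lin iota_inj iotaM iota_g1 iota_g2 iota_g3) => [a z w|z w|].
- by rewrite linD linD' !iota_lin opprD addrACA scalerBr.
- have iotaD t t' : iota (t + t') = iota t + iota t'.
    by rewrite -[t]scale1r iota_lin !scale1r.
  by rewrite mulD mulD' !iotaD !iotaM mulWBl mulWBr opprD addrACA.
- by rewrite DD'g2 subrr.
Qed.

End Plane.

Theorem theorem4p1 (F : fieldType) (F_char0 : [pchar F] =i pred0)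
    (V : vectType F) (v1 v2 : V) (v_basis : basis_of {:V} [:: v1; v2]) :
  let W2 := commutative_mults V in
  let S2 := traceless_commutative_mults V in
  [/\ forall Delta : subvs_of S2 -> subvs_of S2,
        is_2local_derivation (sub_mul (mulW v1) S2) Delta ->
        is_derivation (sub_mul (mulW v1) S2) Delta,
      forall Delta : subvs_of W2 -> subvs_of W2,
        is_2local_derivation (sub_mul (mulW v1) W2) Delta ->
        is_derivation (sub_mul (mulW v1) W2) Delta
    & forall Delta : multiplication V -> multiplication V,
        is_2local_derivation (mulW v1) Delta ->
        is_derivation (mulW v1) Delta].
Proof.
move=> W2 S2.
(* Characteristic zero enters through the primes 2 and 3. *)
have prime_neq0 p : prime p -> p%:R != 0 :> F.
  by move=> p_pr; have := F_char0 p; rewrite !inE p_pr => /negbT.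
have two_neq0 := prime_neq0 2 isT; have three_neq0 := prime_neq0 3 isT.
have sub_case (U : {vspace multiplication V}) :
    (S2 <= U)%VS ->
    (forall A B, A \in U -> B \in U -> mulW v1 A B \in U) ->
    forall Delta, is_2local_derivation (sub_mul (mulW v1) U) Delta ->
      is_derivation (sub_mul (mulW v1) U) Delta.
  move=> S2U U_mul.
  apply: (is_2local_derivation_over_S2 v_basis two_neq0 three_neq0
    (iota := fun u : subvs_of U => vsval u)).
  - by move=> a x y; rewrite linearP.
  - exact: subvs_inj.
  - by move=> u w; rewrite sub_mulE.
  - by move=> B /(subvP S2U) B_U; exists (vsproj U B); rewrite vsprojK.
split.
- by apply: sub_case; [exact: subvv|exact: traceless_commutative_mults_mul].
- by apply: sub_case; [exact: capvSl|exact: commutative_mults_mul].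
- apply: (is_2local_derivation_over_S2 v_basis two_neq0 three_neq0 (iota := id)) => //.
  by move=> B _; exists B.
Qed.
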